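(* For each $\mathbf{SUB}\in\{\mathbf{NFL},\mathbf{FL},\mathbf{BCI},\mathbf{BCK},\mathbf{BCW}\}$, $\mathbf{SUB}$ is sound in the frame class $\mathbb{SUB}$: if $\varphi\vdash\psi$ is derivable in $\mathbf{SUB}$, then $[\![\varphi]\!]_{\mathfrak N}\subseteq[\![\psi]\!]_{\mathfrak N}$ for every SUB-model $\mathfrak N$ on every frame in $\mathbb{SUB}$.
   Context: Frames. A frame is $\mathfrak F=(X,\perp,Y,R)$ with $X,Y$ nonempty sets, $\perp\subseteq X\times Y$, $R\subseteq X^3$ (write $xRzz'$). Let $I=(X\times Y)\setminus\perp$; standing assumption: each $x$ has some $y$ with $xIy$ and each $y$ has some $x$ with $xIy$. For $U\subseteq X$, $W\subseteq Y$: $U^\perp=\{y:\forall x\in U\,(x\perp y)\}$, ${}^\perp W=\{x:\forall y\in W\,(x\perp y)\}$; $A\subseteq X$ is stable if ${}^\perp(A^\perp)=A$. Preorder $x\preceq z$ iff $\{x\}^\perp\subseteq\{z\}^\perp$. Constraints: (C1) for all $w,z,u,v\in X$: $\exists x(xRuv\wedge zRxw)$ iff $\exists x(xRvw\wedge zRux)$; (C2) $xRzz'$ iff $xRz'z$; (C3) $xRzz'$ implies $z'\preceq x$; (C4) $xRxx$. Classes: $\mathbb{NFL}$ all frames; $\mathbb{FL}$: (C1); $\mathbb{BCI}$: (C1),(C2); $\mathbb{BCK}$: (C1),(C2),(C3); $\mathbb{BCW}$: (C1),(C2),(C4). Logics. Language: $\varphi::=p_i\mid\top\mid\bot\mid\varphi\wedge\varphi\mid\varphi\vee\varphi\mid\varphi\circ\varphi\mid\varphi\to\varphi\mid\varphi\leftarrow\varphi$.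 An NFL-algebra is a bounded lattice with binary operations $\circ,\to,\leftarrow$ such that $a\circ b\le c$ iff $b\le a\to c$ iff $a\le c\leftarrow b$; FL-algebra: plus $\circ$ associative; BCI-algebra: FL-algebra with $\circ$ commutative; BCK-algebra: BCI-algebra with $b\circ a\le a$; BCW-algebra: BCI-algebra with $a\wedge b\le a\circ b$. $\varphi\vdash\psi$ is derivable in $\mathbf{SUB}$ iff $v(\varphi)\le v(\psi)$ for every SUB-algebra and every valuation $v$ ($\top\mapsto1,\bot\mapsto0$). Models. $yR^\partial zz'$ iff for all $x\in X$, $xRzz'$ implies $x\perp y$. A SUB-model $\mathfrak N=(\mathfrak F,V)$ assigns a stable set $V(p_i)$ to each $p_i$; each $\varphi$ gets $[\![\varphi]\!]\subseteq X$, $(\!|\varphi|\!)\subseteq Y$ with $(\!|\varphi|\!)=[\![\varphi]\!]^\perp$, $[\![\varphi]\!]={}^\perp(\!|\varphi|\!)$, where: $[\![p_i]\!]=V(p_i)$; $[\![\top]\!]=X$; $(\!|\bot|\!)=Y$; $[\![\varphi\wedge\psi]\!]=[\![\varphi]\!]\cap[\![\psi]\!]$; $(\!|\varphi\vee\psi|\!)=(\!|\varphi|\!)\cap(\!|\psi|\!)$; $[\![\varphi\to\psi]\!]=\{x:\forall z\in X\,\forall y\in Y\,(z\in[\![\varphi]\!]\wedge y\in(\!|\psi|\!)\Rightarrow yR^\partial zx)\}$; $(\!|\varphi\circ\psi|\!)=\{y:\forall z,x\in X\,(z\in[\![\varphi]\!]\wedge x\in[\![\psi]\!]\Rightarrow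 yR^\partial zx)\}$; $[\![\psi\leftarrow\varphi]\!]=\{x:\forall y\in Y\,\forall z\in X\,(y\in(\!|\psi|\!)\wedge z\in[\![\varphi]\!]\Rightarrow yR^\partial xz)\}$.
   Formalization: A model is required to satisfy, for every formula φ, both identities (|φ|)=[[φ]]^⊥ and [[φ]]=^⊥(|φ|); a stable valuation alone does not guarantee them, as the clauses for → and ← can give non-stable sets, where soundness fails. *)

(* Defs.v *)
From HB Require Import structures.
From mathcomp Require Import all_boot all_order.
From mathcomp Require Import boolp classical_sets.

Set Implicit Arguments.
Unset Strict Implicit.
Unset Printing Implicit Defensive.

Local Open Scope classical_set_scope.

Inductive logic := NFL | FL | BCI | BCK | BCW.

Inductive form :=
  | Var of nat
  | Top
  | Bot
  | And of form & form
  | Or of form & form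
  | Circ of form & form
  | Imp of form & form
  | Limp of form & form. (* [Limp c b] is c <- b *)

(* [limp c b] is c <- b. *)
HB.mixin Record isNFLAlgebra (d : Order.disp_t) T of Order.TBLattice d T := {
  circ : T -> T -> T;
  imp : T -> T -> T;
  limp : T -> T -> T;
  circ_impE : forall a b c : T, (circ a b <= c)%O = (b <= imp a c)%O;
  circ_limpE : forall a b c : T, (circ a b <= c)%O = (a <= limp c b)%O
}.

#[short(type="nflAlgType")]
HB.structure Definition NFLAlgebra (d : Order.disp_t) :=
  {T of isNFLAlgebra d T & Order.TBLattice d T}.

Definition circ_assoc d (A : nflAlgType d) :=
  forall a b c : A, circ a (circ b c) = circ (circ a b) c.

Definition circ_comm d (A : nflAlgType d) :=
  forall a b : A, circ a b = circ b a.

Definition algebra_of (S : logic) d (A : nflAlgType d) : Prop :=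
  match S with
  | NFL => True
  | FL => circ_assoc A
  | BCI => circ_assoc A /\ circ_comm A
  | BCK => [/\ circ_assoc A, circ_comm A &
             forall a b : A, (circ b a <= a)%O]
  | BCW => [/\ circ_assoc A, circ_comm A &
             forall a b : A, (Order.meet a b <= circ a b)%O]
  end.

Fixpoint aeval d (A : nflAlgType d) (v : nat -> A) (phi : form) : A :=
  match phi with
  | Var i => v i
  | Top => Order.top
  | Bot => Order.bottom
  | And p q => Order.meet (aeval v p) (aeval v q)
  | Or p q => Order.join (aeval v p) (aeval v q)
  | Circ p q => circ (aeval v p) (aeval v q)
  | Imp p q => imp (aeval v p) (aeval v q)
  | Limp q p => limp (aeval v q) (aeval v p)
  end.

Definition derivable (S : logic) (phi psi : form) : Prop :=
  forall (d : Order.disp_t) (A : nflAlgType d), algebra_of S A ->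
  forall v : nat -> A, (aeval v phi <= aeval v psi)%O.

(* [R x z z'] is x R z z'. *)
Record frame := Frame {
  X : Type;
  Y : Type;
  perp : X -> Y -> Prop;
  R : X -> X -> X -> Prop;
  X_nonempty : [set: X] !=set0;
  Y_nonempty : [set: Y] !=set0;
  I_totalX : forall x : X, exists y : Y, ~ perp x y;
  I_totalY : forall y : Y, exists x : X, ~ perp x y
}.

Section FrameTheory.
Variable F : frame.

Definition rperp (U : set (X F)) : set (Y F) :=
  [set y | forall x, U x -> perp x y].

Definition lperp (W : set (Y F)) : set (X F) :=
  [set x | forall y, W y -> perp x y].

Definition stable (A : set (X F)) : Prop := lperp (rperp A) = A.

Definition preceq (x z : X F) : Prop := rperp [set x] `<=` rperp [set z].

Definition Rdual (y : Y F) (z z' : X F) : Prop :=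
  forall x : X F, R x z z' -> perp x y.

Definition C1 : Prop := forall w z u v : X F,
  (exists x, R x u v /\ R z x w) <-> (exists x, R x v w /\ R z u x).

Definition C2 : Prop := forall x z z' : X F, R x z z' <-> R x z' z.

Definition C3 : Prop := forall x z z' : X F, R x z z' -> preceq z' x.

Definition C4 : Prop := forall x : X F, R x x x.

Definition frame_of (S : logic) : Prop :=
  match S with
  | NFL => True
  | FL => C1
  | BCI => C1 /\ C2
  | BCK => [/\ C1, C2 & C3]
  | BCW => [/\ C1, C2 & C4]
  end.

(* The pair of the extension and the co-extension of a formula: each connective
   fixes one component, the other one is its Galois image. *)
Fixpoint interp (V : nat -> set (X F)) (phi : form) : set (X F) * set (Y F) :=
  let of_ext (A : set (X F)) := (A, rperp A) in
  let of_coext (W : set (Y F)) := (lperp W, W) in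
  match phi with
  | Var i => of_ext (V i)
  | Top => of_ext [set: X F]
  | Bot => of_coext [set: Y F]
  | And p q => of_ext ((interp V p).1 `&` (interp V q).1)
  | Or p q => of_coext ((interp V p).2 `&` (interp V q).2)
  | Circ p q => of_coext [set y | forall z x : X F,
      (interp V p).1 z -> (interp V q).1 x -> Rdual y z x]
  | Imp p q => of_ext [set x | forall (z : X F) (y : Y F),
      (interp V p).1 z -> (interp V q).2 y -> Rdual y z x]
  | Limp q p => of_ext [set x | forall (y : Y F) (z : X F),
      (interp V q).2 y -> (interp V p).1 z -> Rdual y x z]
  end.

End FrameTheory.

(* Sections of R need not be Galois sets, so the clauses for the two
   implications may yield sets that are not stable. [model_ext] and
   [model_coext] express that the two components of the interpretation of every
   formula determine each other. They restrict nothing but the implications,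
   and cannot be dropped: if the extension of p -> q is not stable, then it is
   strictly smaller than that of (p -> q) \/ (p -> q), although
   (p -> q) \/ (p -> q) |- p -> q is derivable in every logic considered. *)
Record model (F : frame) := Model {
  valuation : nat -> set (X F);
  valuation_stable : forall i, stable (valuation i);
  model_ext : forall phi, (interp valuation phi).1 = lperp (interp valuation phi).2;
  model_coext : forall phi, (interp valuation phi).2 = rperp (interp valuation phi).1
}.

Definition ext (F : frame) (N : model F) (phi : form) : set (X F) :=
  (interp (valuation N) phi).1.

(* Main.v *)
Require Import Defs.
From HB Require Import structures.
From mathcomp Require Import all_boot all_order.
From mathcomp Require Import boolp classical_sets.

Local Open Scope classical_set_scope.

(** The extensions of formulas in a model form an NFL-algebra: the clauses for
    fusion and the implications are residuated on sets that are Galois stable,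
    and extensions in a model are. Validity of a derivable sequent is then its
    validity in this algebra under the valuation of the model, so it remains to
    see that each frame condition gives the matching algebraic law.
    Associativity needs the sets to be definable and not merely stable. Writing
    P(a,b) for the image of a x b under R, the set P(P(a,b),c) lies in an
    extension d iff P(a,b) lies in d <- c; the latter is the extension of a
    formula, hence stable, so this says that a o b lies in d <- c, i.e. that
    (a o b) o c lies in d. (C1) says P(P(a,b),c) = P(a,P(b,c)). *)

(** * Residuation and the frame conditions on extensions of formulas *)

Section DefinableSets.
Variables (F : frame) (N : model F).
Implicit Types p q r : form.

Definition rimage (A B : set (X F)) : set (X F) :=
  [set x | exists z z', [/\ A z, B z' & R x z z']].

Lemma extE p : ext N p = lperp (rperp (ext N p)).
Proof. by rewrite /ext {1}model_ext model_coext. Qed.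

(** Allows a formula to be replaced, under any connective, by another one with the same
    extension. *)
Lemma eq_ext_interp p p' :
  ext N p = ext N p' -> interp (valuation N) p = interp (valuation N) p'.
Proof.
move=> e; rewrite [LHS]surjective_pairing [RHS]surjective_pairing !model_coext.
by move: e; rewrite /ext => ->.
Qed.

Lemma sub_ext_coext (A : set (X F)) r :
  A `<=` ext N r <-> forall x y, A x -> (interp (valuation N) r).2 y -> perp x y.
Proof.
rewrite /ext model_ext; split=> [h x y Ax ry | h x Ax y ry].
  exact: (h x Ax y ry).
exact: h.
Qed.

(** By the standing assumption on frames no point is perpendicular to all of Y, so the extension of
    [Bot] is empty. *)
Lemma ext_Bot_sub p : ext N Bot `<=` ext N p.
Proof. by move=> x /= x_perp; have [y []] := I_totalX x; exact: x_perp. Qed.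

Lemma ext_Or_sub p q r :
  ext N (Or p q) `<=` ext N r <-> ext N p `<=` ext N r /\ ext N q `<=` ext N r.
Proof.
split=> [h | [hp hq]].
  by split=> x hx; apply: h; rewrite /ext /= => y [hp hq];
    move: hx; rewrite /ext model_ext; apply.
move=> x hx; rewrite extE => y hy; apply: hx.
by rewrite !model_coext; split=> z hz; apply: hy; [exact: hp | exact: hq].
Qed.

Lemma ext_Circ_sub p q r :
  ext N (Circ p q) `<=` ext N r <-> rimage (ext N p) (ext N q) `<=` ext N r.
Proof.
split=> [h x [z [z' [pz qz' xzz']]] | h x hx].
  by apply: h; rewrite /ext /= => y /(_ _ _ pz qz'); exact.
rewrite extE => y hy; apply: hx => z z' pz qz' w wzz'.
by apply: hy; apply: h; exists z, z'.
Qed.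

(** [B] ranges over arbitrary sets because it will be a raw image under R, which need not be
    stable. *)
Lemma sub_ext_Imp (B : set (X F)) p r :
  B `<=` ext N (Imp p r) <-> rimage (ext N p) B `<=` ext N r.
Proof.
rewrite (sub_ext_coext _ r) [ext N (Imp p r)]/ext /=.
split=> [h x y [z [z' [pz Bz' xzz']]] ry | h z' Bz' z y pz ry x xzz'].
  exact: (h z' Bz' z y pz ry).
by apply: h ry; exists z, z'.
Qed.

Lemma sub_ext_Limp (A : set (X F)) q r :
  A `<=` ext N (Limp r q) <-> rimage A (ext N q) `<=` ext N r.
Proof.
rewrite (sub_ext_coext _ r) [ext N (Limp r q)]/ext /=.
split=> [h x y [z [z' [Az qz' xzz']]] ry | h z Az y z' ry qz' x xzz'].
  exact: (h z Az y z' ry qz').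
by apply: h ry; exists z, z'.
Qed.

Lemma ext_Circ_Imp p q r :
  ext N (Circ p q) `<=` ext N r <-> ext N q `<=` ext N (Imp p r).
Proof. by rewrite ext_Circ_sub sub_ext_Imp. Qed.

Lemma ext_Circ_Limp p q r :
  ext N (Circ p q) `<=` ext N r <-> ext N p `<=` ext N (Limp r q).
Proof. by rewrite ext_Circ_sub sub_ext_Limp. Qed.

Lemma rimageA (A B C : set (X F)) : C1 F ->
  rimage (rimage A B) C = rimage A (rimage B C).
Proof.
move=> c1; rewrite eqEsubset; split=> x.
  move=> [t [w [[u [v [Au Bv tuv]] Cw xtw]]]].
  have [s [svw xus]] := (c1 w x u v).1 (ex_intro _ t (conj tuv xtw)).
  by exists u, s; split=> //; exists v, w.
move=> [u [s [Au [v [w [Bv Cw svw]]] xus]]].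
have [t [tuv xtw]] := (c1 w x u v).2 (ex_intro _ s (conj svw xus)).
by exists t, w; split=> //; exists u, v.
Qed.

Lemma ext_CircA_sub p q r s : C1 F ->
  ext N (Circ p (Circ q r)) `<=` ext N s <->
  ext N (Circ (Circ p q) r) `<=` ext N s.
Proof.
(* Residuating the outer fusion leaves the inner one alone on the left of an inclusion, where it can
   be exchanged for its raw image. *)
move=> c1; rewrite ext_Circ_Imp ext_Circ_sub sub_ext_Imp.
by rewrite ext_Circ_Limp ext_Circ_sub sub_ext_Limp rimageA.
Qed.

Lemma ext_CircA p q r : C1 F ->
  ext N (Circ p (Circ q r)) = ext N (Circ (Circ p q) r).
Proof. by move=> c1; rewrite eqEsubset; split; apply/ext_CircA_sub. Qed.

Lemma ext_CircC p q : C2 F -> ext N (Circ p q) = ext N (Circ q p).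
Proof.
move=> c2; rewrite eqEsubset; split; apply/ext_Circ_sub =>
  x [z [z' [pz qz' xzz']]];
  by apply: (proj1 (ext_Circ_sub _ _ _) (@subset_refl _ _));
  exists z', z; split=> //; apply/c2.
Qed.

(** Extensions are stable, hence upward closed for [preceq]. *)
Lemma ext_Circ_subr p q : C3 F -> ext N (Circ q p) `<=` ext N p.
Proof.
move=> c3; apply/ext_Circ_sub => x [z [z' [_ pz' /c3 le_z'x]]].
by rewrite extE => y hy; apply: le_z'x (erefl : [set x] x) => _ ->; exact: hy.
Qed.

Lemma ext_And_sub_Circ p q : C4 F -> ext N (And p q) `<=` ext N (Circ p q).
Proof.
move=> c4 x [px qx]; apply: (proj1 (ext_Circ_sub p q _) (@subset_refl _ _)).
by exists x, x.
Qed.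

End DefinableSets.

(** * The algebra of definable sets *)

Section DefinableAlgebra.
Variables (F : frame) (N : model F).

(** Taking sets rather than formulas makes inclusion antisymmetric. The sets are definable because
    an implication between arbitrary stable sets may fail to be stable. *)
Definition definable : Type := {A : set (X F) | exists p, ext N p = A}.

HB.instance Definition _ := gen_eqMixin definable.
HB.instance Definition _ := gen_choiceMixin definable.

Definition def_of (p : form) : definable :=
  exist _ (ext N p) (ex_intro _ p erefl).

(** A chosen defining formula, through which the connectives act on sets; by [eq_ext_interp] the
    choice does not affect the result. *)
Definition form_of (a : definable) : form := projT1 (cid (svalP a)).

Lemma ext_form_of a : ext N (form_of a) = sval a.
Proof. exact: projT2 (cid (svalP a)). Qed.

Lemma ext_form_of_def p : ext N (form_of (def_of p)) = ext N p.
Proof. by rewrite ext_form_of. Qed.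

Lemma interp_form_of_def p :
  interp (valuation N) (form_of (def_of p)) = interp (valuation N) p.
Proof. exact/eq_ext_interp/ext_form_of_def. Qed.

Lemma definable_inj a b : ext N (form_of a) = ext N (form_of b) -> a = b.
Proof.
by rewrite !ext_form_of; apply: eq_sig_hprop => A; exact: Prop_irrelevance.
Qed.

Definition def_le (a b : definable) : bool :=
  `[< ext N (form_of a) `<=` ext N (form_of b) >].

Lemma def_leP a b :
  reflect (ext N (form_of a) `<=` ext N (form_of b)) (def_le a b).
Proof. exact: asboolP. Qed.

Fact def_le_refl : reflexive def_le.
Proof. by move=> a; apply/def_leP. Qed.

Fact def_le_anti : antisymmetric def_le.
Proof.
move=> a b /andP[/def_leP ab /def_leP ba].
by apply: definable_inj; rewrite eqEsubset.
Qed.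

Fact def_le_trans : transitive def_le.
Proof.
by move=> b a c /def_leP ab /def_leP bc; apply/def_leP; exact: subset_trans bc.
Qed.

Fact definable_display : Order.disp_t. Proof. exact: Order.Disp tt tt. Qed.

HB.instance Definition _ := Order.Le_isPOrder.Build definable_display definable
  def_le_refl def_le_anti def_le_trans.

Definition def_meet (a b : definable) := def_of (And (form_of a) (form_of b)).
Definition def_join (a b : definable) := def_of (Or (form_of a) (form_of b)).
Definition def_circ (a b : definable) := def_of (Circ (form_of a) (form_of b)).
Definition def_imp (a b : definable) := def_of (Imp (form_of a) (form_of b)).
Definition def_limp (a b : definable) := def_of (Limp (form_of a) (form_of b)).

Fact def_meetP a b c : def_le a (def_meet b c) = def_le a b && def_le a c.
Proof.
apply/def_leP/andP; rewrite ext_form_of_def.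
  by move=> h; split; apply/def_leP => x /h [].
by move=> [/def_leP ab /def_leP ac] x ax; split; [exact: ab | exact: ac].
Qed.

Fact def_joinP a b c : def_le (def_join a b) c = def_le a c && def_le b c.
Proof.
apply/def_leP/andP; rewrite ext_form_of_def ext_Or_sub => -[/def_leP ? /def_leP ?];
  by split.
Qed.

HB.instance Definition _ := Order.POrder_MeetJoin_isLattice.Build
  definable_display definable def_meetP def_joinP.

Fact def_le0x a : def_le (def_of Bot) a.
Proof. by apply/def_leP; rewrite ext_form_of_def; exact: ext_Bot_sub. Qed.

Fact def_lex1 a : def_le a (def_of Top).
Proof. by apply/def_leP; rewrite ext_form_of_def. Qed.

HB.instance Definition _ :=
  Order.hasBottom.Build definable_display definable def_le0x.
HB.instance Definition _ :=
  Order.hasTop.Build definable_display definable def_lex1.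

Fact def_circ_impE a b c : def_le (def_circ a b) c = def_le b (def_imp a c).
Proof.
by apply/def_leP/def_leP; rewrite !ext_form_of_def => /ext_Circ_Imp.
Qed.

Fact def_circ_limpE a b c : def_le (def_circ a b) c = def_le a (def_limp c b).
Proof.
by apply/def_leP/def_leP; rewrite !ext_form_of_def => /ext_Circ_Limp.
Qed.

HB.instance Definition _ := isNFLAlgebra.Build definable_display definable
  def_circ_impE def_circ_limpE.

(** The truth lemma: it turns an inequality in the algebra into an inclusion of extensions. *)
Lemma aeval_definable p : aeval (def_of \o Var) p = def_of p.
Proof.
by elim: p => //= p -> q ->; apply: definable_inj;
  rewrite !ext_form_of_def /ext /= !interp_form_of_def.
Qed.

Lemma definable_circ_assoc : C1 F -> circ_assoc definable.
Proof.
move=> c1 a b c; apply: definable_inj; rewrite !ext_form_of_def.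
have := ext_CircA F N (form_of a) (form_of b) (form_of c) c1.
(* The formula chosen for an inner fusion need not be that fusion, but it has the same
   interpretation. *)
by rewrite /ext /= !interp_form_of_def.
Qed.

Lemma definable_circ_comm : C2 F -> circ_comm definable.
Proof.
by move=> c2 a b; apply: definable_inj; rewrite !ext_form_of_def ext_CircC.
Qed.

Lemma algebra_of_definable S : frame_of F S -> algebra_of S definable.
Proof.
case: S => //= [c1 | [c1 c2] | [c1 c2 c3] | [c1 c2 c4]].
- exact: definable_circ_assoc.
- by split; [exact: definable_circ_assoc | exact: definable_circ_comm].
- split; [exact: definable_circ_assoc | exact: definable_circ_comm | move=> a b].
  by apply/def_leP; rewrite ext_form_of_def; exact: ext_Circ_subr.
- split; [exact: definable_circ_assoc | exact: definable_circ_comm | move=> a b].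
  by apply/def_leP; rewrite !ext_form_of_def; exact: ext_And_sub_Circ.
Qed.

End DefinableAlgebra.

Theorem theorem3p7 (S : logic) (phi psi : form) :
  derivable S phi psi ->
  forall (F : frame), frame_of F S ->
  forall (N : model F), ext N phi `<=` ext N psi.
Proof.
move=> phi_psi F FS N.
have /def_leP := phi_psi _ _ (algebra_of_definable F N S FS) (def_of F N \o Var).
by rewrite !aeval_definable !ext_form_of_def.
Qed.
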